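(* The set $\mathsf{StS}$ of strongly surjective orders in $\mathsf{Lin}$ is $\mathbf{\Sigma}^1_1$-hard, and the set $\mathsf{StS}\setminus\mathsf{Scat}$ of non-scattered strongly surjective orders in $\mathsf{Lin}$ is (lightface) $\Sigma^1_1$ and $\mathbf{\Sigma}^1_1$-complete.
   Context: All linear orders are assumed non-empty. An epimorphism from $M$ onto $L$ is an order preserving surjection $M\to L$; an embedding of $L$ into $M$ is an order preserving injection. A linear order $M$ is strongly surjective if for every linear order $L$ that embeds into $M$ there is an epimorphism from $M$ onto $L$. A linear order is scattered if $\mathbb{Q}$ does not embed into it. $\mathsf{Lin}$ is the (recursive) Polish space of all linear orders $\leq_K$ on (non-empty) subsets $K$ of $\mathbb{N}$, viewed as a subspace of $2^{\mathbb{N}\times\mathbb{N}}$. $\mathsf{StS}$ and $\mathsf{Scat}$ are the sets of strongly surjective, respectively scattered, orders in $\mathsf{Lin}$. $\Sigma^1_1$ denotes the lightface (effective) class and $\mathbf{\Sigma}^1_1$ the boldface class of analytic sets. A set $A$ in a Polish space is $\Gamma$-hard if every set in $\Gamma$ of a zero-dimensional Polish space is the preimage of $A$ under a continuous map, and $\Gamma$-complete if moreover $A \in \Gamma$. *)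

(* Defs.v *)
From HB Require Import structures.
From mathcomp Require Import all_boot all_order all_algebra.
From mathcomp Require Import all_classical all_reals.
From mathcomp Require Import topology.

Set Implicit Arguments.
Unset Strict Implicit.
Unset Printing Implicit Defensive.

Import Order.TTheory.
Local Open Scope classical_set_scope.

Definition embeds {d d'} (L : orderType d) (M : orderType d') : Prop :=
  exists f : L -> M, injective f /\ {homo f : x y / (x <= y)%O}.

Definition epimorphic {d d'} (M : orderType d) (L : orderType d') : Prop :=
  exists f : M -> L, (forall l, exists m, f m = l) /\
    {homo f : x y / (x <= y)%O}.

(* [orderType] allows the empty order, hence [inhabited L]. *)
Definition strongly_surjective {d} (M : orderType d) : Prop :=
  forall (d' : Order.disp_t) (L : orderType d'),
    inhabited L -> embeds L M -> epimorphic M L.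

Definition scattered {d} (M : orderType d) : Prop := ~ embeds rat M.

Definition linear_order_on (K : set nat) (r : nat -> nat -> bool) : Prop :=
  [/\ forall i j, r i j -> K i /\ K j,
      forall i, K i -> r i i,
      forall i j, r i j -> r j i -> i = j,
      forall i j k, r i j -> r j k -> r i k &
      forall i j, K i -> K j -> r i j || r j i].

(* A relation is identified with its characteristic function; [lin_set], seen
   as a type, carries the topology induced by the product of discrete spaces. *)
Definition lin_set : set {ptws (nat * nat) -> bool} :=
  [set x | exists K : set nat, K !=set0 /\ linear_order_on K (fun i j => x (i, j))].

Definition Lin : topologicalType := lin_set.

Definition lin_rel (x : Lin) (i j : nat) : bool := set_val x (i, j).

(* By reflexivity the domain of the order is the diagonal of the relation. *)
Definition lin_dom (x : Lin) : Type := {n : nat | lin_rel x n n}.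

HB.instance Definition _ (x : Lin) := SubType.on (lin_dom x).
HB.instance Definition _ (x : Lin) := [Choice of lin_dom x by <:].

Section LinOrder.
Variable x : Lin.

Definition lin_le (i j : lin_dom x) : bool := lin_rel x (val i) (val j).

Lemma lin_relP : exists K : set nat, K !=set0 /\ linear_order_on K (lin_rel x).
Proof. exact: (set_valP x). Qed.

Lemma lin_le_anti : antisymmetric lin_le.
Proof.
move=> i j /andP[ij ji]; apply: val_inj.
by have [K [_ [_ _ anti _ _]]] := lin_relP; exact: anti.
Qed.

Lemma lin_le_trans : transitive lin_le.
Proof.
move=> j i k; have [K [_ [_ _ _ trans _]]] := lin_relP; exact: trans.
Qed.

Lemma lin_le_total : total lin_le.
Proof.
move=> i j; have [K [_ [dom _ _ _ tot]]] := lin_relP.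
by apply: tot; [case: (dom _ _ (valP i))|case: (dom _ _ (valP j))].
Qed.

Fact lin_display : Order.disp_t. Proof. exact: Order.Disp tt tt. Qed.

HB.instance Definition _ :=
  @Order.Le_isPOrder.Build lin_display (lin_dom x) lin_le
    (fun i => valP i) lin_le_anti lin_le_trans.
HB.instance Definition _ :=
  @Order.POrder_isTotal.Build lin_display (lin_dom x) lin_le_total.

End LinOrder.

Definition StS : set Lin := [set x | strongly_surjective (lin_dom x)].

Definition Scat : set Lin := [set x | scattered (lin_dom x)].

Section Polish.
Variable R : realType.
Local Open Scope ring_scope.

Definition completely_metrizable (T : topologicalType) : Prop :=
  exists d : T -> T -> R,
    [/\ forall x y, d x y = 0 <-> x = y,
        forall x y, d x y = d y x,
        forall x y z, d x z <= d x y + d y z,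
        forall (x : T) (A : set T),
          nbhs x A <-> exists2 e : R, 0 < e & [set y | d x y < e] `<=` A &
        forall u : nat -> T,
          (forall e : R, 0 < e -> exists N : nat, forall m n : nat,
             (N <= m)%N -> (N <= n)%N -> d (u m) (u n) < e) ->
          exists l : T, u @ \oo --> l].

Definition polish (T : topologicalType) : Prop :=
  (exists2 D : set T, countable D & dense D) /\ completely_metrizable T.

(* Stronger than [zero_dimensional], which only asks that clopen sets separate
   points; the two notions differ for Polish spaces (complete Erdos space). *)
Definition clopen_based (T : topologicalType) : Prop :=
  exists2 B : set (set T), B `<=` clopen & basis B.

(* [Y] may be empty, so the empty set is analytic. *)
Definition analytic (T : topologicalType) : set (set T) :=
  [set A | exists Y : topologicalType, polish Y /\
             exists f : Y -> T, continuous f /\ range f = A].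

Section Hardness.
Variable Gamma : forall X : topologicalType, set (set X).

Definition hard (T : topologicalType) (A : set T) : Prop :=
  forall X : topologicalType, polish X -> clopen_based X ->
  forall B : set X, Gamma B ->
    exists f : X -> T, continuous f /\ B = f @^-1` A.

Definition complete (T : topologicalType) (A : set T) : Prop :=
  Gamma A /\ hard A.

End Hardness.

End Polish.

(* Kleene's partial recursive functions with two total oracles
   x : nat -> nat -> bool and y : nat -> nat. Programs are untyped in their
   arity: a missing argument is read as 0, except by [Prec], which is undefined
   on the empty list. *)
Inductive prog : Type :=
| Zero
| Succ
| Proj of nat
| AskX
| AskY
| Comp of prog & seq prog
| Prec of prog & prog
| Mu of prog.

Section Computation.
Variables (x : nat -> nat -> bool) (y : nat -> nat).

Inductive computes : prog -> seq nat -> nat -> Prop :=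
| computes_zero v : computes Zero v 0
| computes_succ v : computes Succ v (nth 0 v 0).+1
| computes_proj i v : computes (Proj i) v (nth 0 v i)
| computes_askX v : computes AskX v (x (nth 0 v 0) (nth 0 v 1))
| computes_askY v : computes AskY v (y (nth 0 v 0))
| computes_comp f gs v ws r :
    computes_all gs v ws -> computes f ws r -> computes (Comp f gs) v r
| computes_prec0 f g v r : computes f v r -> computes (Prec f g) (0 :: v) r
| computes_precS f g n v a r :
    computes (Prec f g) (n :: v) a -> computes g [:: n, a & v] r ->
    computes (Prec f g) (n.+1 :: v) r
| computes_mu f n v (k : nat -> nat) :
    (forall m, m < n -> computes f (m :: v) (k m).+1) -> computes f (n :: v) 0 ->
    computes (Mu f) v n
with computes_all : seq prog -> seq nat -> seq nat -> Prop :=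
| computes_all_nil v : computes_all [::] v [::]
| computes_all_cons g gs v w ws :
    computes g v w -> computes_all gs v ws -> computes_all (g :: gs) v (w :: ws).

End Computation.

(* Lightface classes: the semirecursive, i.e. effectively open, subsets of
   Lin x N^N are the domains of the partial recursive functionals. *)
Definition Sigma01 (P : set (Lin * (nat -> nat))) : Prop :=
  exists e : prog, forall (x : Lin) (y : nat -> nat),
    P (x, y) <-> exists r, computes (lin_rel x) y e [::] r.

Definition Pi01 (P : set (Lin * (nat -> nat))) : Prop := Sigma01 (~` P).

Definition Sigma11 (A : set Lin) : Prop :=
  exists2 P : set (Lin * (nat -> nat)),
    Pi01 P & A = [set x | exists y, P (x, y)].

(* Main.v *)
Require Import Defs.
From HB Require Import structures.
From mathcomp Require Import all_boot all_order all_algebra.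
From mathcomp Require Import all_classical all_reals topology.
From mathcomp Require Import zify.

(** Since [rat] embeds every countable order and surjects onto it, a countable
    non-scattered order is strongly surjective exactly when it surjects onto
    [rat]. By a back-and-forth argument this amounts to the existence of a system
    of intervals, cofinal in both directions, each containing two successive
    intervals of the system; this is a [Pi01] condition on a real coding it, and
    the reals coding such a system together with the order form a closed subset
    of the Baire space.

    For hardness, an analytic set is the set of [x] whose tree [T x] is
    ill-founded. Repeat every child of a node infinitely often and order the
    children of a node like the negative integers before it and like the positive
    ones after it. If the tree is ill-founded, the ill-founded nodes are dense and
    unbounded in the resulting order [A], so that [A] times [int + 1] surjects
    onto [rat]. If [A] times [int + 1] surjects onto [A] times [int], then the
    last copy of [A] maps onto a final segment, so [A] contains copies of [A + A]
    and hence a dense set of pairs between which [A] embeds; as the integers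
    between two labels are finitely many, such pairs occur below some child of
    every node where they occur, and this yields an infinite branch. *)

Set Implicit Arguments.
Unset Strict Implicit.
Unset Printing Implicit Defensive.

Import Order.TTheory GRing.Theory Num.Theory.
Local Open Scope classical_set_scope.

(** * Orders with a dense quotient *)

(* The relation [f p < f q], for [f] an epimorphism onto a dense order without
   endpoints. *)
Record condensation {d} (M : orderType d) (ll : M -> M -> Prop) : Prop :=
  Condensation {
    ll_lt : forall p q, ll p q -> (p < q)%O;
    ll_mono : forall p p' q q', (p <= p')%O -> ll p' q' -> (q' <= q)%O -> ll p q;
    ll_cotrans : forall p q, ll p q -> forall m, ll p m \/ ll m q;
    ll_dense : forall p q, ll p q -> exists m, ll p m /\ ll m q;
    ll_above : forall p, exists m, ll p m;
    ll_below : forall p, exists m, ll m p }.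

Lemma seq_max {d} (T : orderType d) (s : seq T) (t : T) : t \in s ->
  exists2 m, m \in s & forall u, u \in s -> (u <= m)%O.
Proof.
elim: s t => [//|a s IHs] t _; case: s IHs => [|b s] IHs.
  by exists a; rewrite ?mem_head// => u; rewrite inE => /eqP->.
have [m ms mP] := IHs b (mem_head b s).
have [am|/ltW ma] := leP a m.
  exists m; first by rewrite inE ms orbT.
  by move=> u; rewrite inE => /predU1P[->//|/mP].
exists a; first exact: mem_head.
by move=> u; rewrite inE => /predU1P[->//|/mP/le_trans]; apply.
Qed.

Lemma seq_min {d} (T : orderType d) (s : seq T) (t : T) : t \in s ->
  exists2 m, m \in s & forall u, u \in s -> (m <= u)%O.
Proof.
elim: s t => [//|a s IHs] t _; case: s IHs => [|b s] IHs.
  by exists a; rewrite ?mem_head// => u; rewrite inE => /eqP->.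
have [m ms mP] := IHs b (mem_head b s).
have [ma|/ltW am] := leP m a.
  exists m; first by rewrite inE ms orbT.
  by move=> u; rewrite inE => /predU1P[->//|/mP].
exists a; first exact: mem_head.
by move=> u; rewrite inE => /predU1P[->//|/mP]; apply: le_trans.
Qed.

(** * Back-and-forth construction of epimorphisms *)

Section BackAndForth.
Context {d d'} (M : orderType d) (L : orderType d').
Variable ll : M -> M -> Prop.
Hypothesis llP : condensation ll.

(** Preimages of distinct values are separated by [ll], not just by [<], which leaves room to insert
    further points between them. *)
Definition partial_epi (h : seq (M * L)) : Prop :=
  forall p q, p \in h -> q \in h -> (p.2 < q.2)%O -> ll p.1 q.1.

(** [U] collects the lower bounds imposed on the value of [m], [V] the upper ones. By cotransitivity
    no element of [U] exceeds one of [V], so the maximum of [U] or the minimum of [V] will do. *)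
Lemma partial_epi_forth h m : inhabited L -> partial_epi h ->
  exists a, partial_epi ((m, a) :: h).
Proof.
move=> [a0] hP.
pose U := [seq p.2 | p <- h & `[< ~ ll m p.1 >]].
pose V := [seq p.2 | p <- h & `[< ~ ll p.1 m >]].
have UV u v : u \in U -> v \in V -> (u <= v)%O.
  move=> /mapP[p]; rewrite mem_filter => /andP[/asboolP mp ph ->].
  move=> /mapP[q]; rewrite mem_filter => /andP[/asboolP qm qh ->].
  rewrite leNgt; apply/negP => /(hP _ _ qh ph) /(ll_cotrans llP)/(_ m).
  by case.
suff [a [aU aV]] : exists a, (forall u, u \in U -> (u <= a)%O) /\
    (forall v, v \in V -> (a <= v)%O).
  exists a => p q; rewrite !inE => /predU1P[->|ph] /predU1P[->|qh] /=.
  - by rewrite ltxx.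
  - move=> aq; apply: contrapT => mq; move: aq; apply/negP; rewrite -leNgt.
    by apply: aU; apply: map_f; rewrite mem_filter qh andbT; apply/asboolP.
  - move=> pa; apply: contrapT => pm; move: pa; apply/negP; rewrite -leNgt.
    by apply: aV; apply: map_f; rewrite mem_filter ph andbT; apply/asboolP.
  - exact: hP.
have [/eqP U0|[u uU]] : (U == [::]) \/ exists u, u \in U.
  by case: (U) => [|u s]; [left|right; exists u; rewrite mem_head].
  have [/eqP V0|[v vV]] : (V == [::]) \/ exists v, v \in V.
    by case: (V) => [|u s]; [left|right; exists u; rewrite mem_head].
    by exists a0; rewrite U0 V0.
  by have [m' _ m'P] := seq_min vV; exists m'; rewrite U0.
by have [m' m'U m'P] := seq_max uU; exists m'; split=> // v; apply: UV.
Qed.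

(** A point between the preimages of smaller and of larger values comes from the density of [ll], or
    from its unboundedness if one side is empty. *)
Lemma partial_epi_back h l : inhabited M -> partial_epi h ->
  exists m, partial_epi ((m, l) :: h).
Proof.
move=> [m0] hP.
pose U := [seq p.1 | p <- h & (p.2 < l)%O].
pose V := [seq p.1 | p <- h & (l < p.2)%O].
have UV u v : u \in U -> v \in V -> ll u v.
  move=> /mapP[p]; rewrite mem_filter => /andP[pl ph ->].
  move=> /mapP[q]; rewrite mem_filter => /andP[lq qh ->].
  exact: hP (lt_trans pl lq).
suff [m [mU mV]] : exists m, (forall u, u \in U -> ll u m) /\
    (forall v, v \in V -> ll m v).
  exists m => p q; rewrite !inE => /predU1P[->|ph] /predU1P[->|qh] /=.
  - by rewrite ltxx.
  - by move=> lq; apply: mV; apply: map_f; rewrite mem_filter qh andbT.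
  - by move=> pl; apply: mU; apply: map_f; rewrite mem_filter ph andbT.
  - exact: hP.
have [/eqP U0|[u uU]] : (U == [::]) \/ exists u, u \in U.
  by case: (U) => [|u s]; [left|right; exists u; rewrite mem_head].
  have [/eqP V0|[v vV]] : (V == [::]) \/ exists v, v \in V.
    by case: (V) => [|u s]; [left|right; exists u; rewrite mem_head].
    by exists m0; rewrite U0 V0.
  have [m' _ m'P] := seq_min vV; have [m mm'] := ll_below llP m'.
  exists m; rewrite U0; split=> // w /m'P; exact: (ll_mono llP (lexx _)).
have [m' m'U m'P] := seq_max uU.
have [/eqP V0|[v vV]] : (V == [::]) \/ exists v, v \in V.
  by case: (V) => [|w s]; [left|right; exists w; rewrite mem_head].
  have [m mm'] := ll_above llP m'.
  exists m; rewrite V0; split=> // w /m'P wm'.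
  exact: (ll_mono llP wm' mm' (lexx _)).
have [n nV nP] := seq_min vV; have [m [m'm mn]] := ll_dense llP (UV _ _ m'U nV).
exists m; split=> w.
  by move=> /m'P wm'; apply: (ll_mono llP wm' m'm (lexx _)).
by move=> /nP; apply: (ll_mono llP (lexx _)).
Qed.

Lemma partial_epi_step (h : {h | partial_epi h}) (m : option M) (l : option L) :
  inhabited M -> inhabited L ->
  exists h' : {h | partial_epi h}, [/\ {subset sval h <= sval h'},
    forall m', m = Some m' -> exists a, (m', a) \in sval h' &
    forall l', l = Some l' -> exists b, (b, l') \in sval h'].
Proof.
case: h => h hP iM iL /=.
have [h1 [h1P hh1 mh1]] : exists h1, [/\ partial_epi h1, {subset h <= h1} &
    forall m', m = Some m' -> exists a, (m', a) \in h1].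
  case: m => [m|]; last by exists h; split.
  have [a aP] := partial_epi_forth m iL hP.
  exists ((m, a) :: h); split=> // [p ph|m' [<-]]; first by rewrite inE ph orbT.
  by exists a; rewrite mem_head.
case: l => [l|]; last by exists (exist _ h1 h1P); split.
have [b bP] := partial_epi_back l iM h1P.
exists (exist _ _ bP); split=> /= [p /hh1 ph|m' /mh1[a ah]|l' [<-]].
- by rewrite inE ph orbT.
- by exists a; rewrite inE ah orbT.
- by exists b; rewrite mem_head.
Qed.

Lemma condensation_epimorphic :
  (exists f : M -> nat, injective f) -> (exists g : L -> nat, injective g) ->
  inhabited M -> inhabited L -> epimorphic M L.
Proof.
move=> [cM cM_inj] [cL cL_inj] iM iL.
have dec (T : Type) (c : T -> nat) : injective c ->
    exists e : nat -> option T, forall t, e (c t) = Some t.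
  move=> c_inj.
  have /choice[e eP] : forall n, exists o : option T,
      forall t, c t = n -> o = Some t.
    move=> n; have [[t tn]|nt] := pselect (exists t, c t = n).
      by exists (Some t) => t'; rewrite -tn => /c_inj->.
    by exists None => t tn; case: nt; exists t.
  by exists e => t; apply: eP.
have [eM eMP] := dec _ _ cM_inj; have [eL eLP] := dec _ _ cL_inj.
(* Stage [n] treats the points of code [n] on both sides, if there are any. *)
have /choice[step stepP] (hn : {h | partial_epi h} * nat) :=
  partial_epi_step hn.1 (eM hn.2) (eL hn.2) iM iL.
have h0P : partial_epi [::] by [].
pose h n := nat_rect (fun=> {h | partial_epi h}) (exist _ [::] h0P)
  (fun n hn => step (hn, n)) n.
have hS n : {subset sval (h n) <= sval (h n.+1)}.
  by have [] := stepP (h n, n).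
have h_mono m n : m <= n -> {subset sval (h m) <= sval (h n)}.
  move=> /subnK <-; elim: (n - m) => [//|k IHk] p /IHk.
  by rewrite addSn; apply: hS.
have h_compare m n p q : p \in sval (h m) -> q \in sval (h n) ->
    (p.2 < q.2)%O -> ll p.1 q.1.
  move=> /(h_mono _ _ (leq_maxl m n)) ph /(h_mono _ _ (leq_maxr m n)) qh.
  exact: (svalP (h (maxn m n))).
(* Applied both ways to a point with two values, this shows that the union of the stages is
   single-valued. *)
have h_le m n p q : p \in sval (h m) -> q \in sval (h n) ->
    (p.1 <= q.1)%O -> (p.2 <= q.2)%O.
  move=> ph qh pq; rewrite leNgt; apply/negP => /(h_compare _ _ _ _ qh ph).
  by move=> /(ll_lt llP); rewrite ltNge pq.
have /choice[f fP] (m : M) : exists a, exists n, (m, a) \in sval (h n).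
  have [_ /(_ m) + _] := stepP (h (cM m), cM m).
  by rewrite eMP => /(_ erefl)[a aP]; exists a, (cM m).+1.
exists f; split=> [l|m m' mm'].
  have [_ _ /(_ l)] := stepP (h (cL l), cL l).
  rewrite eLP => /(_ erefl)[m mP]; exists m; have [n nP] := fP m.
  have {}mP : (m, l) \in sval (h (cL l).+1) by exact: mP.
  apply/eqP; rewrite eq_le.
  by rewrite (h_le _ _ _ _ nP mP)//= (h_le _ _ _ _ mP nP).
have [n nP] := fP m; have [n' n'P] := fP m'; exact: h_le nP n'P _.
Qed.

End BackAndForth.

(** The last clause is monotonicity of [f] in contrapositive form; it compares values of the section
    also with points outside its range. *)
Lemma epimorphic_section {d d'} (M : orderType d) (L : orderType d') :
  epimorphic M L -> exists (f : M -> L) (g : L -> M),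
    [/\ cancel g f, {homo f : x y / (x <= y)%O} &
        forall m l, (f m < l)%O -> (m < g l)%O].
Proof.
move=> [f [/choice[g gK] f_mono]]; exists f, g; split=> // m l ml.
by rewrite ltNge; apply/negP => /f_mono; rewrite gK leNgt ml.
Qed.

Lemma epimorphic_embeds {d d'} (M : orderType d) (L : orderType d') :
  epimorphic M L -> embeds L M.
Proof.
move=> /epimorphic_section[f [g [gK f_mono fg]]]; exists g; split.
  exact: can_inj gK.
move=> x y; rewrite le_eqVlt => /predU1P[->//|xy].
by apply/ltW/fg; rewrite gK.
Qed.

Lemma epimorphic_rat_condensation {d} (M : orderType d) :
  epimorphic M rat -> exists ll : M -> M -> Prop, condensation ll.
Proof.
move=> /epimorphic_section[f [g [gK f_mono fg]]].
exists (fun p q => (f p < f q)%O); split.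
- move=> p q pq; rewrite ltNge; apply/negP => /f_mono.
  by rewrite leNgt pq.
- move=> p p' q q' /f_mono pp' p'q' /f_mono qq'.
  exact: le_lt_trans pp' (lt_le_trans p'q' qq').
- move=> p q pq m; have [pm|mp] := ltP (f p) (f m); first by left.
  by right; apply: le_lt_trans mp pq.
- move=> p q pq; exists (g (((f p + f q) / 2%:R)%R)).
  by rewrite gK; split; rewrite Num.Theory.midf_lt.
- by move=> p; exists (g (f p + 1)%R); rewrite gK Num.Theory.ltrDl.
- move=> p; exists (g (f p - 1)%R).
  by rewrite gK Num.Theory.ltrBlDr Num.Theory.ltrDl.
Qed.

Lemma lin_dom_inhabited (x : Lin) : inhabited (lin_dom x).
Proof.
have [K [[n Kn] [_ refl _ _ _]]] := lin_relP x.
exact: inhabits (exist _ n (refl _ Kn)).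
Qed.

Lemma embeds_lin_countable {d} (L : orderType d) (x : Lin) :
  embeds L (lin_dom x) -> exists g : L -> nat, injective g.
Proof. by move=> [g [g_inj _]]; exists (val \o g) => i j /val_inj/g_inj. Qed.

Lemma StS_nonscatP (x : Lin) : (StS `\` Scat) x <->
  exists ll : lin_dom x -> lin_dom x -> Prop, condensation ll.
Proof.
have cx : exists g : lin_dom x -> nat, injective g.
  by exists val; apply: val_inj.
split=> [[xS /contrapT xQ]|[ll llP]].
  exact/epimorphic_rat_condensation/(xS _ _ (inhabits 0%R)).
split.
  move=> d L iL Lx.
  exact: condensation_epimorphic llP cx (embeds_lin_countable Lx)
    (lin_dom_inhabited x) iL.
apply; apply: epimorphic_embeds.
apply: (condensation_epimorphic llP) => //.
- by exists pickle; apply: pcan_inj pickleK.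
- exact: lin_dom_inhabited.
- exact: inhabits 0%R.
Qed.

(** * Definability *)

(* The slots 0 and 1 of [y] hold the endpoints of intervals; slots 2 and 3 the
   indices of two intervals, one after the other, inside the [n]-th one; slots 4
   and 5 the indices of intervals above and below the point [n]. As one universal
   quantifier over [n] suffices, no pairing function has to be programmed. *)
Section Splitting.
Variables (rel : nat -> nat -> bool) (y : nat -> nat).

Definition slot k n := y (6 * n + k).

Definition splits n : bool :=
  [&& rel (slot 0 n) (slot 1 n), ~~ rel (slot 1 n) (slot 0 n),
      rel (slot 0 n) (slot 0 (slot 2 n)),
      rel (slot 1 (slot 2 n)) (slot 0 (slot 3 n)),
      rel (slot 1 (slot 3 n)) (slot 1 n) &
      ~~ [&& rel n n & ~~ (rel n (slot 0 (slot 4 n)) &&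
                           rel (slot 1 (slot 5 n)) n)]].

End Splitting.

Lemma splits_condensation (x : Lin) (y : nat -> nat) :
  (forall n, splits (lin_rel x) y n) ->
  exists ll : lin_dom x -> lin_dom x -> Prop, condensation ll.
Proof.
move=> yP; have [K [_ [dom refl _ _ _]]] := lin_relP x.
have domx i j : lin_rel x i j -> lin_rel x i i /\ lin_rel x j j.
  by move=> /dom[/refl ? /refl].
have aP n : lin_rel x (slot y 0 n) (slot y 0 n).
  by have /and5P[/domx[]] := yP n.
have bP n : lin_rel x (slot y 1 n) (slot y 1 n).
  by have /and5P[/domx[]] := yP n.
pose a n : lin_dom x := exist _ (slot y 0 n) (aP n).
pose b n : lin_dom x := exist _ (slot y 1 n) (bP n).
have ab n : (a n < b n)%O.
  by have /and5P[_ ba _ _ _] := yP n; rewrite ltNge.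
have al n : (a n <= a (slot y 2 n))%O by have /and5P[] := yP n.
have blr n : (b (slot y 2 n) <= a (slot y 3 n))%O by have /and5P[] := yP n.
have br n : (b (slot y 3 n) <= b n)%O by have /and5P[_ _ _ _ /andP[]] := yP n.
have uv (p : lin_dom x) : (p <= a (slot y 4 (val p)))%O &&
    (b (slot y 5 (val p)) <= p)%O.
  have /and5P[_ _ _ _ /andP[_]] := yP (val p).
  by rewrite negb_and negbK => /orP[/negP[]|//]; apply: valP p.
exists (fun p q => exists n, (p <= a n)%O /\ (b n <= q)%O); split.
- by move=> p q [n [pa /(lt_le_trans (ab n))]]; apply: le_lt_trans.
- move=> p p' q q' pp' [n [p'a bq']] q'q; exists n.
  by split; [apply: le_trans p'a|apply: le_trans q'q].
(* Either [m] lies beyond the left one of the two inner intervals, or it lies before the right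
   one. *)
- move=> p q [n [pa bq]] m; have [bm|mb] := leP (b (slot y 2 n)) m.
    by left; exists (slot y 2 n); split=> //; apply: le_trans (al n).
  right; exists (slot y 3 n); split; last exact: le_trans bq.
  exact/ltW/(lt_le_trans mb).
- move=> p q [n [pa bq]]; exists (b (slot y 2 n)); split.
    by exists (slot y 2 n); split=> //; apply: le_trans (al n).
  by exists (slot y 3 n); split=> //; apply: le_trans bq.
- move=> p; exists (b (slot y 4 (val p))), (slot y 4 (val p)); split=> //.
  by have /andP[] := uv p.
- move=> p; exists (a (slot y 5 (val p))), (slot y 5 (val p)); split=> //.
  by have /andP[] := uv p.
Qed.

Lemma condensation_splits (x : Lin) (ll : lin_dom x -> lin_dom x -> Prop) :
  condensation ll -> exists y, forall n, splits (lin_rel x) y n.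
Proof.
move=> llP; have [p0] := lin_dom_inhabited x.
have [q0 p0q0] := ll_above llP p0.
pose code (p q : lin_dom x) := pickle (val p, val q).
(* The intervals are all the [ll]-related pairs; an index coding none of them stands for [(p0, q0)],
   so that every [n] names an interval. *)
have /choice[e eP] : forall n, exists pq : lin_dom x * lin_dom x,
    ll pq.1 pq.2 /\ forall p q, ll p q -> code p q = n -> pq = (p, q).
  move=> n; have [[[p q] [pq cn]]|no] :=
      pselect (exists pq, ll pq.1 pq.2 /\ code pq.1 pq.2 = n).
    exists (p, q); split=> // p' q' _; rewrite -cn.
    by move=> /(pcan_inj pickleK)[/val_inj-> /val_inj->].
  by exists (p0, q0); split=> // p q pq cn; case: no; exists (p, q).
have eK p q : ll p q -> e (code p q) = (p, q).
  by move=> pq; have [_] := eP (code p q); apply.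
have e_lt n : ll (e n).1 (e n).2 by have [] := eP n.
have /choice[s sP] : forall n, exists m, ll (e n).1 m /\ ll m (e n).2.
  by move=> n; apply: ll_dense.
have /choice[u uP] : forall n, exists m, forall i : lin_dom x, val i = n ->
    (i <= (e m).1)%O.
  move=> n; have [[i iE]|no] := pselect (exists i : lin_dom x, val i = n);
    last first.
    by exists 0 => i iE; case: no; exists i.
  have [q iq] := ll_above llP i; exists (code i q) => j.
  rewrite -iE => /val_inj->.
  by rewrite eK.
have /choice[v vP] : forall n, exists m, forall i : lin_dom x, val i = n ->
    ((e m).2 <= i)%O.
  move=> n; have [[i iE]|no] := pselect (exists i : lin_dom x, val i = n);
    last first.
    by exists 0 => i iE; case: no; exists i.
  have [q iq] := ll_below llP i; exists (code q i) => j.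
  rewrite -iE => /val_inj->.
  by rewrite eK.
(* The inner intervals of the [n]-th one are its two parts cut at [s n]; the remainder modulo 6
   selects the slot. *)
exists (fun i => let n := i %/ 6 in nth 0 [:: val (e n).1; val (e n).2;
  code (e n).1 (s n); code (s n) (e n).2; u n; v n] (i %% 6)) => n.
rewrite /splits /slot !(mulnC 6) !divnMDl// !modnMDl// !divn_small// !addn0 /=.
have [sl sr] := sP n; rewrite !eK//=.
have lt_rel (p q : lin_dom x) : (p < q)%O ->
    lin_rel x (val p) (val q) && ~~ lin_rel x (val q) (val p).
  by move=> pq; apply/andP; split; [apply: (ltW pq)|rewrite ltNge in pq].
have /andP[-> ->] := lt_rel _ _ (ll_lt llP (e_lt n)).
have le_refl (p : lin_dom x) : lin_rel x (val p) (val p) := valP p.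
rewrite !le_refl /=; apply/negP => /andP[nn /negP]; apply.
pose i : lin_dom x := exist _ n nn.
by apply/andP; split; [apply: (uP n i)|apply: (vP n i)].
Qed.

Lemma StS_nonscat_splits (x : Lin) :
  (StS `\` Scat) x <-> exists y, forall n, splits (lin_rel x) y n.
Proof.
split=> [/StS_nonscatP[ll]|[y /splits_condensation/StS_nonscatP//]].
exact: condensation_splits.
Qed.

(* Programs deciding the splitting condition *)
Scheme computes_mind := Minimality for computes Sort Prop
  with computes_all_mind := Minimality for computes_all Sort Prop.

Section Programs.
Variables (x : nat -> nat -> bool) (y : nat -> nat).

Lemma computes_inj p v r r' :
  computes x y p v r -> computes x y p v r' -> r = r'.
Proof.
move=> pr; move: r'.
apply: (@computes_mind x y
  (fun p v r => forall r', computes x y p v r' -> r = r')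
  (fun ps v ws => forall ws', computes_all x y ps v ws' -> ws = ws'))
  pr => {p v r}.
- by move=> v r' H; inversion H.
- by move=> v r' H; inversion H.
- by move=> i v r' H; inversion H.
- by move=> v r' H; inversion H.
- by move=> v r' H; inversion H.
- move=> f gs v ws r _ IHg _ IHf r' H; inversion H; subst.
  by apply: IHf; rewrite (IHg _ ltac:(eassumption)).
- by move=> f g v r _ IH r' H; inversion H; subst; apply: IH.
- move=> f g n v a r _ IHa _ IHr r' H; inversion H; subst.
  by apply: IHr; rewrite (IHa _ ltac:(eassumption)).
- move=> f n v k _ IHk _ IH0 r' H; 
  inversion H as [| | | | | | | |? ? ? k' H1 H2]; subst.
  (* If the two stopping points differed, [f] would return both 0 and a successor at the smaller
     one. *)
  case: (ltngtP n r') => // [/H1/IH0//|/IHk/(_ _ H2)//].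
- by move=> v ws' H; inversion H.
- move=> g gs v w ws _ IHw _ IHws ws' H; inversion H; subst.
  by rewrite (IHw _ ltac:(eassumption)) (IHws _ ltac:(eassumption)).
Qed.

Fixpoint Plus k p := if k is k'.+1 then Comp Succ [:: Plus k' p] else p.
(** In a recursion step argument 1 is the previous value, so the recursion here multiplies by 6. *)
Definition Slot k p :=
  Comp AskY [:: Plus k (Comp (Prec Zero (Plus 6 (Proj 1))) [:: p])].
Definition Rel p q := Comp AskX [:: p; q].
(** Recursion acts as a case distinction on the truth value in first position; in [And], [Proj 2]
    then reads the second conjunct. *)
Definition Not p := Comp (Prec (Plus 1 Zero) Zero) [:: p].
Definition And p q := Comp (Prec Zero (Proj 2)) [:: p; q].

Lemma computes_comp1 f g v w r :
  computes x y g v w -> computes x y f [:: w] r ->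
  computes x y (Comp f [:: g]) v r.
Proof.
move=> gw; apply: computes_comp; apply: computes_all_cons gw _.
exact: computes_all_nil.
Qed.

Lemma computes_comp2 f g g' v w w' r : computes x y g v w ->
  computes x y g' v w' -> computes x y f [:: w; w'] r ->
  computes x y (Comp f [:: g; g']) v r.
Proof.
move=> gw gw'; apply: computes_comp.
apply: computes_all_cons gw _; apply: computes_all_cons gw' _.
exact: computes_all_nil.
Qed.

Lemma computes_Plus k p v n :
  computes x y p v n -> computes x y (Plus k p) v (k + n).
Proof.
elim: k => [//|k IHk] /IHk pn; rewrite addSn.
exact/(computes_comp1 pn)/(computes_succ x y [:: k + n]).
Qed.

Lemma computes_Slot k p v n :
  computes x y p v n -> computes x y (Slot k p) v (slot y k n).
Proof.
move=> pn; rewrite /slot addnC.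
apply: computes_comp1; last exact: (computes_askY x y [:: k + 6 * n]).
apply/computes_Plus/(computes_comp1 pn).
elim: {pn} n => [|n IHn]; first exact/computes_prec0/computes_zero.
rewrite mulnS; apply: computes_precS IHn _.
exact/computes_Plus/(computes_proj x y 1 [:: n; 6 * n]).
Qed.

Lemma computes_Rel p q v m n : computes x y p v m -> computes x y q v n ->
  computes x y (Rel p q) v (x m n).
Proof.
by move=> pm qn; apply: computes_comp2 pm qn (computes_askX x y [:: m; n]).
Qed.

Lemma computes_Not p v (b : bool) :
  computes x y p v b -> computes x y (Not p) v (~~ b).
Proof.
move=> pb; apply: (computes_comp1 pb).
have p1 : computes x y (Prec (Plus 1 Zero) Zero) [:: 0] 1.
  exact/computes_prec0/(computes_Plus 1)/computes_zero.
by case: b {pb} => //=; apply: (computes_precS p1); apply: computes_zero.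
Qed.

Lemma computes_And p q v (b c : bool) :
  computes x y p v b -> computes x y q v c -> computes x y (And p q) v (b && c).
Proof.
move=> pb qc; apply: (computes_comp2 pb qc).
have p0 : computes x y (Prec Zero (Proj 2)) [:: 0; nat_of_bool c] 0.
  exact/computes_prec0/computes_zero.
case: b {pb} => //=; apply: (computes_precS p0).
exact: (computes_proj x y 2 [:: 0; 0; nat_of_bool c]).
Qed.

Definition Splits : prog :=
  let n := Proj 0 in
  And (Rel (Slot 0 n) (Slot 1 n))
  (And (Not (Rel (Slot 1 n) (Slot 0 n)))
  (And (Rel (Slot 0 n) (Slot 0 (Slot 2 n)))
  (And (Rel (Slot 1 (Slot 2 n)) (Slot 0 (Slot 3 n)))
  (And (Rel (Slot 1 (Slot 3 n)) (Slot 1 n))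
  (Not (And (Rel n n) (Not (And (Rel n (Slot 0 (Slot 4 n)))
                                (Rel (Slot 1 (Slot 5 n)) n))))))))).

Lemma computes_Splits n : computes x y Splits [:: n] (splits x y n).
Proof.
have nP : computes x y (Proj 0) [:: n] n by apply: (computes_proj x y 0 [:: n]).
by do !(first [exact: nP|apply: computes_And|apply: computes_Not|
  apply: computes_Rel|apply: computes_Slot]).
Qed.

(** [Splits] always returns a truth value, so the search for a 0 halts exactly when some [n] fails;
    this makes the complement of the condition semirecursive. *)
Lemma computes_Mu_Splits :
  (exists r, computes x y (Mu Splits) [::] r) <-> ~ forall n, splits x y n.
Proof.
split=> [[r H]|].
  inversion H as [| | | | | | | |? ? ? ? _ H0]; subst => /(_ r) rP.
  by have := computes_inj H0 (computes_Splits r); rewrite rP.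
move=> /existsNP[n /negP nP].
(* The least failure is taken, because the search needs successor values before it; these are all
   1. *)
have [m mP m_min] := ex_minnP (ex_intro (fun n => ~~ splits x y n) n nP).
exists m; apply: (computes_mu (k := fun=> 0)) => [i im|]; last first.
  by have := computes_Splits m; rewrite (negbTE mP).
have := computes_Splits i; case: (boolP (splits x y i)) => // /m_min.
by rewrite leqNgt im.
Qed.

End Programs.

Lemma Sigma11_StS_nonscat : Sigma11 (StS `\` Scat).
Proof.
exists [set xy | forall n, splits (lin_rel xy.1) xy.2 n].
  by exists (Mu Splits) => x y; split=> /computes_Mu_Splits.
by apply/seteqP; split=> x /StS_nonscat_splits.
Qed.

(** * Orders from trees *)

Lemma condensation_dense {d} (M : orderType d) (D : M -> Prop) :
  (forall m, exists2 e, D e & (m < e)%O) ->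
  (forall m, exists2 e, D e & (e < m)%O) ->
  (forall a b, D a -> D b -> (a < b)%O -> exists2 e, D e & (a < e < b)%O) ->
  exists ll : M -> M -> Prop, condensation ll.
Proof.
move=> above below dense_D.
(* Two points of [D] are required, not one: a third one between them then yields both cotransitivity
   and density. *)
exists (fun p q => exists a b, [/\ D a, D b, (a < b)%O, (p <= a)%O & (b <= q)%O]).
split.
- move=> p q [a [b [_ _ ab pa bq]]].
  exact: le_lt_trans pa (lt_le_trans ab bq).
- move=> p p' q q' pp' [a [b [Da Db ab p'a bq']]] q'q.
  by exists a, b; split=> //; [apply: le_trans p'a|apply: le_trans q'q].
- move=> p q [a [b [Da Db ab pa bq]]] m.
  have [e De /andP[ae eb]] := dense_D _ _ Da Db ab.
  by have [em|/ltW me] := leP e m; [left; exists a, e|right; exists e, b].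
- move=> p q [a [b [Da Db ab pa bq]]].
  have [e De /andP[ae eb]] := dense_D _ _ Da Db ab.
  by exists e; split; [exists a, e|exists e, b].
- move=> p; have [a Da /ltW pa] := above p; have [b Db ab] := above a.
  by exists b, a, b.
- move=> q; have [b Db /ltW bq] := below q; have [a Da ab] := below b.
  by exists a, a, b.
Qed.

(** * Suborders of the lexicographic order of words *)

Definition words := seqlexi int.

Lemma ltw_cons (a b : int) (u v : words) :
  ((a :: u : words) < (b :: v : words))%O = (a < b)%O || (a == b) && (u < v)%O.
Proof.
by rewrite Order.SeqLexiOrder.ltxi_cons; case: (ltgtP a b).
Qed.

Section SubLin.
Variable S : words -> bool.

Definition sub_rel (i j : nat) : bool :=
  if (pickle_inv i : option words, pickle_inv j : option words) is (Some u, Some v)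
  then [&& S u, S v & (u <= v)%O] else false.

Hypothesis S0 : exists w, S w.

Lemma sub_rel_lin : lin_set (fun ij => sub_rel ij.1 ij.2).
Proof.
pose K i := if pickle_inv i : option words is Some u then S u else false.
have KP i : K i -> exists2 u : words, pickle_inv i = Some u & S u.
  by rewrite /K; case: pickle_inv => // u Su; exists u.
exists [set i | K i]; split.
  by have [w Sw] := S0; exists (pickle w); rewrite /= /K pickleK_inv.
rewrite /sub_rel; split=> /=.
- by move=> i j; rewrite /K; do 2 case: pickle_inv => // ?; case/and3P.
- by move=> i /KP[u -> ->] /=.
- move=> i j; have := @pickle_invK words i; have := @pickle_invK words j.
  case: (pickle_inv i) (pickle_inv j) => [u|//] [v|//] /= <- <-.
  move=> /and3P[_ _ uv] /and3P[_ _ vu].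
  by rewrite (le_anti (introT andP (conj uv vu))).
- move=> i j k; do 3 case: pickle_inv => // ?.
  move=> /and3P[-> _ uv] /and3P[_ -> vw].
  exact: le_trans uv vw.
- by move=> i j /KP[u -> ->] /KP[v -> ->]; apply: le_total.
Qed.

Definition sub_lin : Lin :=
  exist (fun f => f \in lin_set) _ (mem_set sub_rel_lin).

Lemma lin_rel_sub i j : lin_rel sub_lin i j = sub_rel i j.
Proof. by rewrite /lin_rel set_valE. Qed.

Definition word (i : lin_dom sub_lin) : words := odflt [::] (pickle_inv (val i)).

Lemma pickle_inv_word i : pickle_inv (val i) = Some (word i).
Proof.
have := valP i; rewrite /= lin_rel_sub /sub_rel /word.
by case: pickle_inv.
Qed.

Lemma word_in i : S (word i).
Proof.
have := valP i; rewrite /= lin_rel_sub /sub_rel pickle_inv_word.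
by case/andP.
Qed.

Lemma word_le i j : (i <= j)%O = (word i <= word j)%O.
Proof.
transitivity (lin_rel sub_lin (val i) (val j)); first by [].
by rewrite lin_rel_sub /sub_rel !pickle_inv_word !word_in.
Qed.

Lemma word_lt i j : (i < j)%O = (word i < word j)%O.
Proof. by rewrite !ltNge word_le. Qed.

Lemma word_surj w : S w -> exists i, word i = w.
Proof.
move=> Sw; have ww : lin_rel sub_lin (pickle w) (pickle w).
  by rewrite lin_rel_sub /sub_rel pickleK_inv Sw lexx.
by exists (exist _ (pickle w) ww); rewrite /word /= pickleK_inv.
Qed.

End SubLin.

(** The 2-adic valuation takes every value cofinally in both directions, which repeats each child
    infinitely often on both sides. *)
Definition label (a : int) : nat := logn 2 `|a|%N.

Lemma label_above n (N : int) :
  exists a : int, [/\ (N < a)%O, a != 0%R & label a = n].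
Proof.
exists (Posz (2 ^ n * (2 * `|N|%N + 1))); have := expn_gt0 2 n.
set k := 2 ^ n => /= k0; split; [nia|nia|].
rewrite /label /= lognM// ?pfactorK//; last by lia.
by rewrite logn_coprime ?addn0// coprime2n addn1 /= mul2n odd_double.
Qed.

Lemma label_below n (N : int) :
  exists a : int, [/\ (a < N)%O, a != 0%R & label a = n].
Proof.
have [a [Na a0 an]] := label_above n (- N)%R.
by exists (- a)%R; split; [lia|rewrite oppr_eq0|rewrite /label abszN].
Qed.

(** * Nodes of a tree with repeated children *)

Section TreeOrder.
Implicit Types (T : seq nat -> bool) (w : words).

Definition shift T (a : int) s := T (label a :: s).

Definition illfounded T := exists b : nat -> nat, forall n, T (mkseq b n).

(* The nodes of the tree with integer labels, a node being ended by the letter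
   [0]: its subtree lies partly before and partly after it. *)
Fixpoint node T w : bool :=
  if w is a :: w' then
    T [::] && (if a == 0%R then w' == [::] else node (shift T a) w')
  else false.

Fixpoint illnode T w : Prop :=
  if w is a :: w' then
    T [::] /\ (if a == 0%R then w' = [::] /\ illfounded T
               else illnode (shift T a) w')
  else False.

Lemma illfounded_root T : illfounded T -> T [::].
Proof. by case=> b /(_ 0). Qed.

Lemma illfounded_child T : illfounded T ->
  exists n, forall a, label a = n -> illfounded (shift T a).
Proof.
move=> [b bT]; exists (b 0) => a ab; exists (b \o succn) => n.
have := bT n.+1; rewrite /shift ab /mkseq/= -[1]addn0 iotaDl -map_comp.
by rewrite (@eq_map _ _ _ (b \o succn)).
Qed.

Lemma illfounded_shift T a : T [::] -> illfounded (shift T a) -> illfounded T.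
Proof.
move=> T0 [b bT].
exists (fun n => if n is n'.+1 then b n' else label a) => -[//|n].
rewrite /mkseq/= -[1]addn0 iotaDl -map_comp.
exact: bT.
Qed.

Lemma illnode_node T w : illnode T w -> node T w.
Proof.
elim: w T => //= a w IHw T [->]; case: eqP => _; first by case=> ->.
exact: IHw.
Qed.

Lemma illnode_illfounded T w : illnode T w -> illfounded T.
Proof.
elim: w T => //= a w IHw T [T0]; case: eqP => _; first by case.
by move=> /IHw; apply: illfounded_shift.
Qed.

(** Some child is ill-founded, and its copies occur beyond the first letter of [w]; the word ending
    at such a copy is the witness. *)
Lemma illnode_above T w : illfounded T -> exists2 e, illnode T e & (w < e)%O.
Proof.
move=> ill; have [n nP] := illfounded_child ill.
have [a [wa a0 an]] := label_above n (head 0%R w).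
exists [:: a; 0%R]; last by case: w wa => [//|b w] /= ba; rewrite ltw_cons ba.
have illa := nP _ an.
by rewrite /= (negbTE a0); split; [|split]; rewrite ?illfounded_root.
Qed.

Lemma illnode_below T w : illfounded T -> node T w ->
  exists2 e, illnode T e & (e < w)%O.
Proof.
move=> ill; case: w => [//|b w] _; have [n nP] := illfounded_child ill.
have [a [ab a0 an]] := label_below n b.
exists [:: a; 0%R]; last by rewrite ltw_cons ab.
have illa := nP _ an.
by rewrite /= (negbTE a0); split; [|split]; rewrite ?illfounded_root.
Qed.

(** Consider the first letters that differ. If [v] continues into a subtree there, go above it
    inside that ill-founded subtree; if [v] ends there, go below [w] inside the subtree of [w]. *)
Lemma illnode_dense T v w : illnode T v -> illnode T w -> (v < w)%O ->
  exists2 e, illnode T e & (v < e < w)%O.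
Proof.
elim: v T w => [//|a v IHv] T [//|b w] /= [T0 vP] [_ wP].
rewrite ltw_cons => /orP[ab|/andP[/eqP ab vw]]; last first.
  subst b; case: (eqVneq a 0%R) vP wP => [->|a0] vP wP.
    by move: vw; rewrite vP.1 wP.1 ltxx.
  have [e eP /andP[ve ew]] := IHv _ _ vP wP vw.
  exists (a :: e) => /=; first by rewrite (negbTE a0).
  by rewrite !ltw_cons ltxx eqxx ve ew.
case: (eqVneq a 0%R) vP ab => [->|a0] vP ab.
  have b0 : b != 0%R by rewrite gt_eqF.
  move: wP; rewrite (negbTE b0) => wP; have illb := illnode_illfounded wP.
  have [e eP ew] := illnode_below illb (illnode_node wP).
  exists (b :: e) => /=; first by rewrite (negbTE b0).
  by rewrite !ltw_cons ab ltxx eqxx.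
have [e eP ve] := illnode_above v (illnode_illfounded vP).
exists (a :: e) => /=; first by rewrite (negbTE a0).
by rewrite !ltw_cons ab ltxx eqxx ve.
Qed.

End TreeOrder.

(** * Copies of the order of nodes *)

Section Blocks.
Variable T : seq nat -> bool.
Hypothesis T0 : T [::].

(* [int] copies of the order of the nodes, followed by one more copy. *)
Definition blocks (w : words) : bool :=
  if w is a :: w' then
    (a == 0%R) && node T (behead w') || (a == 1%R) && node T w'
  else false.

Definition blocks0 (w : words) : bool :=
  if w is a :: w' then (a == 0%R) && node T (behead w') else false.

Lemma node0 : node T [:: 0%R].
Proof. by rewrite /= T0. Qed.

Lemma blocks0_neq0 : exists w, blocks0 w.
Proof. by exists [:: 0%R; 0%R; 0%R]; rewrite /= T0. Qed.

Lemma blocks_neq0 : exists w, blocks w.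
Proof. by exists [:: 1%R; 0%R]; rewrite /= T0. Qed.

Definition block_lin : Lin := sub_lin blocks_neq0.
Definition block0_lin : Lin := sub_lin blocks0_neq0.

(** The ill-founded nodes of all copies are dense and unbounded: inside one copy by the lemmas on
    nodes, and between two copies by going up within the lower one. *)
Lemma illfounded_condensation : illfounded T ->
  exists ll : lin_dom block_lin -> lin_dom block_lin -> Prop, condensation ll.
Proof.
move=> ill.
pose ib (w : words) := (exists k u, w = [:: 0%R, k & u] /\ illnode T u) \/
  exists u, w = 1%R :: u /\ illnode T u.
have ib_blocks w : ib w -> blocks w.
  by case=> [[k [u [-> /illnode_node uT]]]|[u [-> /illnode_node uT]]];
    rewrite /= uT ?orbT.
have blocksP w : blocks w -> (exists k u, w = [:: 0%R, k & u] /\ node T u) \/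
    exists u, w = 1%R :: u /\ node T u.
  case: w => [//|a w] /orP[/andP[/eqP-> ]|/andP[/eqP-> wT]].
    by case: w => [//|k u] uT; left; exists k, u.
  by right; exists w.
apply: (@condensation_dense _ _ (fun i => ib (word i))).
- move=> i; have [[k [u [iE _]]]|[u [iE _]]] := blocksP _ (word_in i).
    have [e eP ue] := illnode_above u ill.
    have [j jE] : exists j : lin_dom block_lin, word j = [:: 0%R, k & e].
      by apply: word_surj; apply: ib_blocks; left; exists k, e.
    by exists j; [rewrite jE; left; exists k, e|
      rewrite word_lt iE jE !ltw_cons !eqxx ue !ltxx].
  have [e eP ue] := illnode_above u ill.
  have [j jE] : exists j : lin_dom block_lin, word j = 1%R :: e.
    by apply: word_surj; apply: ib_blocks; right; exists e.
  by exists j; [rewrite jE; right; exists e|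
    rewrite word_lt iE jE !ltw_cons !eqxx ue !ltxx].
- move=> i; have [[k [u [iE uP]]]|[u [iE uP]]] := blocksP _ (word_in i).
    have [e eP ue] := illnode_below ill uP.
    have [j jE] : exists j : lin_dom block_lin, word j = [:: 0%R, k & e].
      by apply: word_surj; apply: ib_blocks; left; exists k, e.
    by exists j; [rewrite jE; left; exists k, e|
      rewrite word_lt iE jE !ltw_cons !eqxx ue !ltxx].
  have [e eP ue] := illnode_below ill uP.
  have [j jE] : exists j : lin_dom block_lin, word j = 1%R :: e.
    by apply: word_surj; apply: ib_blocks; right; exists e.
  by exists j; [rewrite jE; right; exists e|
    rewrite word_lt iE jE !ltw_cons !eqxx ue !ltxx].
move=> i j iv iw; rewrite word_lt => vw.
suff [e eb ve] : exists2 e, ib e & (word i < e < word j)%O.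
  have [k kE] := word_surj blocks_neq0 (ib_blocks _ eb).
  by exists k; rewrite ?word_lt kE.
move: (word i) (word j) iv iw vw => v w iv iw vw.
case: iv vw => [[k [v' [-> v'T]]]|[v' [-> v'T]]].
  case: iw => [[k' [w' [-> w'T]]]|[w' [-> w'T]]] vw.
    move: vw; rewrite !ltw_cons ltxx eqxx /= => /orP[kk'|/andP[/eqP<- v'w']].
      have [e eT v'e] := illnode_above v' ill.
      exists [:: 0%R, k & e]; first by left; exists k, e.
      by rewrite !ltw_cons kk' !ltxx !eqxx v'e.
    have [e eT /andP[v'e ew']] := illnode_dense v'T w'T v'w'.
    exists [:: 0%R, k & e]; first by left; exists k, e.
    by rewrite !ltw_cons !ltxx !eqxx v'e ew'.
  have [e eT v'e] := illnode_above v' ill.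
  exists [:: 0%R, k & e]; first by left; exists k, e.
  by rewrite !ltw_cons !ltxx !eqxx v'e.
case: iw => [[k' [w' [-> w'T]]]|[w' [-> w'T]]] //.
rewrite !ltw_cons ltxx eqxx /= => v'w'.
have [e eT /andP[v'e ew']] := illnode_dense v'T w'T v'w'.
exists (1%R :: e); first by right; exists e.
by rewrite !ltw_cons !ltxx !eqxx v'e ew'.
Qed.

Lemma block0_embeds : embeds (lin_dom block0_lin) (lin_dom block_lin).
Proof.
have /choice[f fP] (i : lin_dom block0_lin) :
    exists j : lin_dom block_lin, word j = word i.
  apply: word_surj; have := word_in i.
  by case: (word i) => //= a w /andP[-> ->].
exists f; split; last by move=> i j; rewrite !word_le !fP.
move=> i j ij; have {ij} : word i = word j by rewrite -!fP ij.
move=> ij; apply/eqP.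
by rewrite eq_le !word_le ij lexx.
Qed.

(* The last copy of the nodes covers a final segment of the [int] copies, so it
   contains infinitely many copies of itself. *)
Lemma epimorphic_copies : epimorphic (lin_dom block_lin) (lin_dom block0_lin) ->
  exists f : nat -> words -> words,
    (forall k u, node T u -> node T (f k u)) /\
    (forall k l u v, node T u -> node T v ->
       (k < l)%N || (k == l) && (u < v)%O -> (f k u < f l v)%O).
Proof.
move=> /epimorphic_section[h [g [gK h_mono hg]]].
have [m mE] : exists m : lin_dom block_lin, word m = [:: 1%R; 0%R].
  by apply: word_surj; rewrite /= T0.
have [n [u0 [nE _]]] : exists n u, word (h m) = [:: 0%R, n & u] /\ node T u.
  have := word_in (h m); case: word => [//|a w] /andP[/eqP->].
  by case: w => [//|n u] uT; exists n, u.
(* The copies after the [n]-th lie above [h m], so the section sends them above [m], that is, into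
   the last copy. *)
pose start k : int := (n + 1 + Posz k)%R.
have fP (ku : nat * words) : exists w, node T ku.2 -> exists e : lin_dom block0_lin,
    [/\ word e = [:: 0%R, start ku.1 & ku.2], word (g e) = 1%R :: w & node T w].
  case: ku => k u /=; have [uT|nuT] := boolP (node T u); last by exists [::].
  have [e eE] : exists e : lin_dom block0_lin, word e = [:: 0%R, start k & u].
    by apply: word_surj.
  have : (m < g e)%O.
    apply: hg; rewrite word_lt nE eE !ltw_cons ltxx eqxx /=.
    by apply/orP; left; rewrite /start; lia.
  rewrite word_lt mE; have := word_in (g e).
  case geE : (word (g e)) => [//|a w] /= /orP[]/andP[/eqP aE wT].
    by rewrite ltw_cons aE.
  by exists w => _; exists e; rewrite -aE.
have [f {}fP] := choice fP.
exists (fun k u => f (k, u)); split=> [k u uT|k l u v uT vT kl].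
  by have [e []] := fP (k, u) uT.
have [e [eE geE _]] := fP (k, u) uT; have [e' [e'E ge'E _]] := fP (l, v) vT.
have : (g e < g e')%O.
  apply: hg; rewrite gK word_lt eE e'E !ltw_cons ltxx eqxx /=.
  case/orP: kl => [kl|/andP[/eqP-> ->]]; last by rewrite eqxx orbT.
  by apply/orP; left; rewrite /start; lia.
by rewrite word_lt geE ge'E ltw_cons ltxx eqxx.
Qed.

End Blocks.

(** * Finding an infinite branch *)

Lemma illfounded_coind (P : (seq nat -> bool) -> Prop) :
  (forall T, P T -> T [::] /\ exists a, P (shift T a)) ->
  forall T, P T -> illfounded T.
Proof.
move=> PS T PT.
have /choice[s sP] (T' : {T | P T}) : exists a, P (shift (sval T') a).
  by have [] := PS _ (svalP T').
pose step (T' : {T | P T}) : {T | P T} := exist _ _ (sP T').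
pose t n := iter n step (exist _ T PT).
(* The starting stage [k] varies, since the tree [t k.+1] is a subtree of [t k] at a child. *)
suff tP n k : sval (t k) [seq label (s (t i)) | i <- iota k n].
  by exists (fun n => label (s (t n))) => n; apply: (tP n 0).
elim: n k => [|n IHn] k; first by have [] := PS _ (svalP (t k)).
exact: IHn k.+1.
Qed.

(* If two related nodes have different first letters, splitting brings these
   letters closer together; so some child inherits a dense relation. *)
Lemma dense_relation_illfounded T (big : words -> words -> Prop) :
  (forall p q, big p q -> [/\ node T p, node T q & (p < q)%O]) ->
  (forall p q, big p q -> exists r, big p r /\ big r q) ->
  (exists p q, big p q) -> illfounded T.
Proof.
move=> bigT big_split big_ex.
pose P T := exists big : words -> words -> Prop,
  [/\ forall p q, big p q -> [/\ node T p, node T q & (p < q)%O],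
      forall p q, big p q -> exists r, big p r /\ big r q & exists p q, big p q].
apply: (@illfounded_coind P); last by exists big.
move=> {bigT big_split big_ex big}T [big [bigT big_split [p [q pq]]]].
split; first by have [] := bigT _ _ pq; case: p {pq} => //= ? ? /andP[].
have [a [u [v auv]]] : exists a u v, big (a :: u) (a :: v).
  have [n] := ubnP `|head 0%R q - head 0%R p|%N.
  elim: n => // n IHn in p q pq *; have [] := bigT _ _ pq.
  case: p q pq => [//|a u] [//|b v] pq /= _ _.
  rewrite ltw_cons => /orP[ab|/andP[/eqP ab _]] ltn; last first.
    by exists a, u, v; rewrite {2}ab.
  have [[|c w] [pr rq]] := big_split _ _ pq; first by have [] := bigT _ _ pr.
  have [_ _] := bigT _ _ pr; have [_ _] := bigT _ _ rq; rewrite !ltw_cons => cb ac.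
  have {}cb : (c < b)%O || (c == b) by case: ltgtP cb.
  have {}ac : (a <= c)%O by case: ltgtP ac.
  (* If [c = b], the pair [r], [q] has a common first letter; otherwise the first letters of [p] and
     [r] are closer than those of [p] and [q]. *)
  case/orP: cb => [cb|/eqP cb]; last by exists c, w, v; rewrite {2}cb.
  by apply: IHn pr _ => /=; lia.
(* The letter 0 ends a node, so two distinct nodes cannot both begin with it. *)
have a0 : a != 0%R.
  apply/eqP => a0; have [] := bigT _ _ auv.
  by rewrite /= a0 eqxx => /andP[_ /eqP->] /andP[_ /eqP->]; rewrite ltxx.
exists a, (fun u v => big (a :: u) (a :: v)); split; last by exists u, v.
  move=> p' q' /bigT[] /=; rewrite (negbTE a0) ltw_cons ltxx eqxx.
  by move=> /andP[_ ->] /andP[_ ->].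
move=> p' q' p'q'; have [[|c w] [pr rq]] := big_split _ _ p'q'.
  by have [] := bigT _ _ pr.
(* A word between two words that begin with [a] begins with [a] as well, so splitting stays inside
   the child. *)
suff ac : c = a by exists w; rewrite ac in pr rq.
have [_ _] := bigT _ _ pr; have [_ _] := bigT _ _ rq; rewrite !ltw_cons.
by case: (ltgtP c a).
Qed.

Lemma epimorphic_illfounded (T : seq nat -> bool) (T0 : T [::]) :
  epimorphic (lin_dom (block_lin T0)) (lin_dom (block0_lin T0)) -> illfounded T.
Proof.
move=> /epimorphic_copies[f [fT f_lt]].
pose between p q := exists g : words -> words,
  [/\ forall u, node T u -> node T (g u) /\ (p < g u < q)%O &
      forall u v, node T u -> node T v -> (u < v)%O -> (g u < g v)%O].
have f_ltS k l u v : node T u -> node T v -> k < l -> (f k u < f l v)%O.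
  by move=> uT vT kl; apply: f_lt; rewrite ?kl.
have f_mono k u v : node T u -> node T v -> (u < v)%O -> (f k u < f k v)%O.
  by move=> uT vT uv; apply: f_lt; rewrite ?uv ?eqxx ?orbT.
have T00 := node0 T0.
apply: (@dense_relation_illfounded _
    (fun p q => [/\ node T p, node T q & between p q])).
- move=> p q [pT qT [g [/(_ _ T00)[_ /andP[pg gq]] _]]].
  by split=> //; apply: lt_trans gq.
(* Inside the embedded copy of the nodes lie three successive copies of them: a point of the middle
   one divides the interval, and the outer two provide the embeddings on either side. *)
- move=> p q [pT qT [g [gT g_lt]]]; exists (g (f 1 [:: 0%R])).
  have [rT /andP[pr rq]] := gT _ (fT 1 _ T00).
  split; split=> //; [exists (g \o f 0)|exists (g \o f 2)]; split=> /=.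
  + move=> u uT; have [guT /andP[pgu _]] := gT _ (fT 0 _ uT).
    by rewrite guT pgu g_lt// ?fT// f_ltS.
  + by move=> u v uT vT uv; apply: g_lt; rewrite ?fT//; apply: f_mono.
  + move=> u uT; have [guT /andP[_ guq]] := gT _ (fT 2 _ uT).
    by rewrite guT guq g_lt// ?fT// f_ltS.
  + by move=> u v uT vT uv; apply: g_lt; rewrite ?fT//; apply: f_mono.
(* Copy 1 lies between any points of the copies 0 and 2. *)
- exists (f 0 [:: 0%R]), (f 2 [:: 0%R]); split; rewrite ?fT//.
  exists (f 1); split=> [u uT|u v]; last exact: f_mono.
  by rewrite fT// !f_ltS.
Qed.

(** * Continuity of the reduction *)

Definition locally_constant (X : topologicalType) (V : Type) (f : X -> V) :=
  forall x, \forall x' \near x, f x' = f x.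

Lemma locally_constant_cst (X : topologicalType) V (v : V) :
  locally_constant (fun _ : X => v).
Proof. by move=> x; apply: nearW. Qed.

Lemma locally_constant2 (X : topologicalType) U V W (h : U -> V -> W)
    (f : X -> U) (g : X -> V) :
  locally_constant f -> locally_constant g ->
  locally_constant (fun x => h (f x) (g x)).
Proof.
move=> fl gl x; by apply: filterS2 (fl x) (gl x) => x' -> ->.
Qed.

Lemma continuous_Lin (X : topologicalType) (f : X -> Lin) :
  (forall i j, locally_constant (fun x => lin_rel (f x) i j)) -> continuous f.
Proof.
move=> fl; apply: (@continuous_comp_initial _ _ _ set_val) => x.
apply/pointwise_cvgP => -[i j] A /= /nbhs_singleton xA.
by have := fl i j x; apply: filterS => x' E;
  rewrite /= /lin_rel in E *; rewrite E.
Qed.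

Section TreeReduction.
Variables (X : topologicalType) (T : X -> seq nat -> bool).
Hypothesis T0 : forall x, T x [::].
Hypothesis T_lc : forall s, locally_constant (fun x => T x s).

Lemma locally_constant_node w : locally_constant (fun x => node (T x) w).
Proof.
elim: w T T_lc => [|a w IHw] T' T'l; first exact: locally_constant_cst.
apply: (locally_constant2 andb); first exact: T'l.
case: (a == 0%R); first exact: locally_constant_cst.
by apply: (IHw (fun x => shift (T' x) a)) => s; apply: T'l.
Qed.

Lemma locally_constant_blocks w : locally_constant (fun x => blocks (T x) w).
Proof.
case: w => [|a w]; first exact: locally_constant_cst.
by apply: (locally_constant2 orb); apply: (locally_constant2 andb);
  (exact: locally_constant_cst || exact: locally_constant_node).
Qed.

Definition tree_reduction (x : X) : Lin := block_lin (T0 x).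

Lemma continuous_tree_reduction : continuous tree_reduction.
Proof.
apply: continuous_Lin => i j; rewrite /tree_reduction.
under eq_fun do rewrite lin_rel_sub.
rewrite /sub_rel; case: pickle_inv => [u|]; last exact: locally_constant_cst.
case: pickle_inv => [v|]; last exact: locally_constant_cst.
by do !apply: (locally_constant2 andb);
  (exact: locally_constant_cst || exact: locally_constant_blocks).
Qed.

Lemma tree_reductionP x : illfounded (T x) -> (StS `\` Scat) (tree_reduction x).
Proof. by move=> /(illfounded_condensation (T0 x)) /StS_nonscatP. Qed.

Lemma tree_reduction_StS x : StS (tree_reduction x) -> illfounded (T x).
Proof.
move=> /(_ _ (lin_dom (block0_lin (T0 x)))) H.
exact/epimorphic_illfounded/H/block0_embeds/lin_dom_inhabited.
Qed.

End TreeReduction.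

(** * Analyticity *)

Definition agree (n : nat) (z z' : nat -> nat) := forall i, i < n -> z' i = z i.

Lemma agree_le m n z z' : m <= n -> agree n z z' -> agree m z z'.
Proof. by move=> mn zz' i im; apply/zz'/(leq_trans im). Qed.

Lemma agree_trans n z z' z'' : agree n z z' -> agree n z' z'' -> agree n z z''.
Proof. by move=> h h' i ni; rewrite h' ?h. Qed.

(** Continuity on the Baire space for the discrete topology on [V]. *)
Definition determined (V : Type) (f : (nat -> nat) -> V) :=
  forall z, exists n, forall z', agree n z z' -> f z' = f z.

Lemma determined_cst V (v : V) : determined (fun=> v).
Proof. by move=> z; exists 0. Qed.

Lemma determined1 U V (h : U -> V) f :
  determined f -> determined (fun z => h (f z)).
Proof. by move=> fd z; have [n nP] := fd z; exists n => z' /nP ->. Qed.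

Lemma determined2 U V W (h : U -> V -> W) f g :
  determined f -> determined g -> determined (fun z => h (f z) (g z)).
Proof.
move=> fd gd z; have [m mP] := fd z; have [n nP] := gd z.
exists (maxn m n) => z' zz'; rewrite mP ?nP//; apply: agree_le zz'.
  exact: leq_maxr.
exact: leq_maxl.
Qed.

Lemma determined_eval f : determined f -> determined (fun z => z (f z)).
Proof.
move=> fd z; have [n nP] := fd z; exists (maxn n (f z).+1) => z' zz'.
have /nP -> : agree n z z' by apply: agree_le zz'; apply: leq_maxl.
exact/zz'/leq_maxr.
Qed.

Definition baire_closed (C : set (nat -> nat)) :=
  forall z, (forall n, exists2 z', C z' & agree n z z') -> C z.

(** The truth value of each clause at [z] depends on finitely many values of [z], and these are
    shared by a member of the set. *)
Lemma determined_closed (I : Type) (f : I -> (nat -> nat) -> bool) :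
  (forall i, determined (f i)) -> baire_closed [set z | forall i, f i z].
Proof.
move=> fd z zC i; have [n nP] := fd i z; have [z' z'C /nP <-] := zC n.
exact: z'C.
Qed.

(** * Closed subsets of the Baire space are Polish *)

Definition baire_sub (C : set (nat -> nat)) : Type := {z : nat -> nat | C z}.

Section BaireSub.
Variable C : set (nat -> nat).
Implicit Types z : baire_sub C.

HB.instance Definition _ := gen_eqMixin (baire_sub C).
HB.instance Definition _ := gen_choiceMixin (baire_sub C).

Lemma baire_sval_inj : injective (fun z => sval z).
Proof.
by move=> [z Cz] [z' Cz'] /= zz'; subst z'; rewrite (Prop_irrelevance Cz Cz').
Qed.

Definition baire_nbhs z : set_system (baire_sub C) :=
  [set A | exists n, forall z', agree n (sval z) (sval z') -> A z'].

HB.instance Definition _ := hasNbhs.Build (baire_sub C) baire_nbhs.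

Lemma baire_nbhs_filter z : ProperFilter (nbhs z).
Proof.
split; first by move=> [n /(_ z)]; apply.
split.
- by exists 0.
- move=> A B [m mA] [n nB]; exists (maxn m n) => z' zz'; split.
    by apply/mA/(agree_le _ zz')/leq_maxl.
  by apply/nB/(agree_le _ zz')/leq_maxr.
- by move=> A B AB [n nA]; exists n => z' /nA/AB.
Qed.

Lemma baire_nbhs_singleton z (A : set (baire_sub C)) : nbhs z A -> A z.
Proof. by move=> [n]; apply. Qed.

Lemma baire_nbhs_nbhs z (A : set (baire_sub C)) :
  nbhs z A -> nbhs z (nbhs^~ A).
Proof.
move=> [n nA]; exists n => z' zz'; exists n => z'' z'z''.
exact/nA/(agree_trans zz').
Qed.

HB.instance Definition _ := Nbhs_isNbhsTopological.Build (baire_sub C)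
  baire_nbhs_filter baire_nbhs_singleton baire_nbhs_nbhs.

Lemma locally_constant_determined V (f : (nat -> nat) -> V) :
  determined f -> locally_constant (fun z => f (sval z)).
Proof. by move=> fd z; have [n nP] := fd (sval z); exists n => z' /nP. Qed.

Variable R : realType.
Local Open Scope ring_scope.

Definition baire_dist z z' : R :=
  if pselect (exists n, sval z n != sval z' n) is left ex then
    (ex_minn ex).+1%:R^-1 else 0.

Lemma baire_distP z z' : (z = z' /\ baire_dist z z' = 0) \/
  exists n, [/\ agree n (sval z) (sval z'), sval z n != sval z' n &
                baire_dist z z' = n.+1%:R^-1].
Proof.
rewrite /baire_dist; case: pselect => [ex|nex].
  right; case: ex_minnP => n nz n_min; exists n; split=> // i ni.
  by apply/eqP; apply: contraTT ni; rewrite eq_sym -leqNgt => /n_min.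
left; split=> //; apply: baire_sval_inj; apply/funext => n; apply/eqP.
by apply: contra_notT nex => nz; exists n.
Qed.

Lemma baire_dist_lt n z z' :
  baire_dist z z' < n.+1%:R^-1 <-> agree n.+1 (sval z) (sval z').
Proof.
have [[-> ->]|[k [kz zk ->]]] := baire_distP z z'; first by rewrite invr_gt0 ltr0n.
rewrite ltf_pV2 ?posrE ?ltr0n// ltr_nat; split=> [nk|/(_ k) zz'].
  exact: agree_le kz.
by rewrite ltnNge; apply: contra zk => /zz' ->.
Qed.

Lemma baire_dist_ge0 z z' : 0 <= baire_dist z z'.
Proof.
by have [[_ ->]|[k [_ _ ->]]] := baire_distP z z'; rewrite ?invr_ge0 ?ler0n.
Qed.

Lemma baire_dist0 z z' : baire_dist z z' = 0 <-> z = z'.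
Proof.
have [[-> ->]//|[k [_ zk ->]]] := baire_distP z z'; split=> [/eqP|zz'].
  by rewrite invr_eq0 pnatr_eq0.
by rewrite zz' eqxx in zk.
Qed.

Lemma baire_dist_sym z z' : baire_dist z z' = baire_dist z' z.
Proof.
have [[-> ->]//|[m [mz zm ->]]] := baire_distP z z'.
have [[zz' _]|[n [nz zn ->]]] := baire_distP z' z.
  by rewrite zz' eqxx in zm.
have [/nz zz'|/mz zz'|->//] := ltngtP m n.
  by rewrite zz' eqxx in zm.
by rewrite zz' eqxx in zn.
Qed.

(** Where [z] and [z''] first differ, [z'] differs from one of them, so one summand alone is large
    enough. *)
Lemma baire_dist_triangle z z' z'' :
  baire_dist z z'' <= baire_dist z z' + baire_dist z' z''.
Proof.
have [[_ ->]|[n [nz zn ->]]] := baire_distP z z''.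
  by rewrite addr_ge0 ?baire_dist_ge0.
have far u v : sval u n != sval v n -> n.+1%:R^-1 <= baire_dist u v.
  move=> uv; rewrite leNgt; apply/negP => /baire_dist_lt/(_ n (ltnSn n)) E.
  by rewrite E eqxx in uv.
have [zz'|/far zz'] := eqVneq (sval z n) (sval z' n).
  rewrite zz' in zn; apply: le_trans (far _ _ zn) _.
  by rewrite lerDr baire_dist_ge0.
by apply: le_trans zz' _; rewrite lerDl baire_dist_ge0.
Qed.

Lemma baire_dist_nbhs z (A : set (baire_sub C)) :
  nbhs z A <-> exists2 e : R, 0 < e & [set z' | baire_dist z z' < e] `<=` A.
Proof.
split=> [[n nA]|[e e0 eA]].
  exists n.+1%:R^-1; first by rewrite invr_gt0 ltr0n.
  by move=> z' /baire_dist_lt zz'; apply: nA; apply: agree_le zz'.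
have [n] := ltr_add_invr e0; rewrite add0r => ne.
by exists n.+1 => z' /baire_dist_lt zz'; apply: eA; apply: lt_trans ne.
Qed.

Lemma baire_complete (u : nat -> baire_sub C) : baire_closed C ->
  (forall e : R, 0 < e -> exists N : nat, forall m n : nat,
     (N <= m)%N -> (N <= n)%N -> baire_dist (u m) (u n) < e) ->
  exists l : baire_sub C, u @ \oo --> l.
Proof.
move=> C_closed u_cauchy.
have /choice[N NP] : forall k, exists N, forall m n, (N <= m)%N -> (N <= n)%N ->
    agree k.+1 (sval (u m)) (sval (u n)).
  move=> k; have [|N NP] := u_cauchy k.+1%:R^-1; first by rewrite invr_gt0 ltr0n.
  by exists N => m n Nm Nn; apply/baire_dist_lt/NP.
(* From index [N n] on, the sequence no longer changes in the places up to [n]; [z] collects these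
   final values. *)
pose z n := sval (u (N n)) n.
have z_agree n m : (\max_(i < n) N i <= m)%N -> agree n z (sval (u m)).
  move=> nm i ni; apply: (NP i) => //; apply: leq_trans nm.
  exact: (leq_bigmax (Ordinal ni)).
have Cz : C z.
  apply: C_closed => n; exists (sval (u (\max_(i < n) N i))); last exact: z_agree.
  exact: svalP.
exists (exist _ z Cz) => A [n nA].
by exists (\max_(i < n) N i)%N => // m /= nm; apply/nA/z_agree.
Qed.

Lemma baire_separable : exists2 D : set (baire_sub C), countable D & dense D.
Proof.
(* The dense set takes one point of [C] for each finite sequence that some point of [C] extends. *)
pose prefix s z := mkseq (sval z) (size s) = s.
have /choice[g gP] : forall s : seq nat, exists o : option (baire_sub C),
    (exists z, prefix s z) -> exists2 z, o = Some z & prefix s z.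
  move=> s; have [[z sz]|no] := pselect (exists z, prefix s z).
    by exists (Some z); exists z.
  by exists None.
exists [set z | exists s, g s = Some z].
  have /choice[c cP] : forall z, exists s, (exists s, g s = Some z) -> g s = Some z.
    move=> z; have [[s sz]|no] := pselect (exists s, g s = Some z).
      by exists s.
    by exists [::].
  apply/countable_injP; exists (pickle \o c) => z z'; rewrite !inE.
  move=> /cP cz /cP cz' /(pcan_inj pickleK) cc.
  by move: cz; rewrite cc cz' => -[].
move=> O [z Oz] Oo; have [n nO] : nbhs z O by apply: open_nbhs_nbhs.
have sz : prefix (mkseq (sval z) n) z by rewrite /prefix size_mkseq.
have [z' gz' sz'] := gP _ (ex_intro _ z sz).
exists z'; split; last by exists (mkseq (sval z) n).
apply: nO => i ni; have := congr1 (fun s => nth 0%N s i) sz'.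
by rewrite size_mkseq !nth_mkseq.
Qed.

Lemma baire_sub_polish : baire_closed C -> polish R (baire_sub C).
Proof.
move=> C_closed; split; first exact: baire_separable.
exists baire_dist; split.
- exact: baire_dist0.
- exact: baire_dist_sym.
- exact: baire_dist_triangle.
- exact: baire_dist_nbhs.
- by move=> u; apply: baire_complete.
Qed.

End BaireSub.

(* A point [z] of the Baire space codes both a relation, by the parities of its
   values, and a function [nat -> nat], by their halves. *)
Definition code_rel (z : nat -> nat) (i j : nat) := odd (z (pickle (i, j))).
Definition code_fun (z : nat -> nat) (n : nat) := (z n)./2.

(** The axioms of a linear order on the diagonal domain, where reflexivity is automatic, in
    quantifier-free form; each instance thus consults finitely many values of a code. *)
Definition lin_clause (r : nat -> nat -> bool) (i j k : nat) : bool :=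
  [&& r i j ==> (r i i && r j j), (r i j && r j i) ==> (i == j),
      (r i j && r j k) ==> r i k & (r i i && r j j) ==> (r i j || r j i)].

Lemma lin_clauseP (r : nat -> nat -> bool) : (exists i, r i i) ->
  (forall i j k, lin_clause r i j k) <-> lin_set (fun ij => r ij.1 ij.2).
Proof.
move=> [i0 ri0]; split=> [rP|].
  exists [set i | r i i]; split; first by exists i0.
  split=> /=.
  - by move=> i j rij; have /and4P[/implyP/(_ rij)/andP] := rP i j 0.
  - by [].
  - move=> i j rij rji; have /and4P[_ /implyP + _ _] := rP i j 0.
    by rewrite rij rji => /(_ erefl)/eqP.
  - move=> i j k rij rjk; have /and4P[_ _ /implyP + _] := rP i j k.
    by rewrite rij rjk; apply.
  - move=> i j ri rj; have /and4P[_ _ _ /implyP] := rP i j 0.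
    by rewrite ri rj; apply.
move=> [K [_ /= [dom refl anti trans tot]]] i j k; apply/and4P; split; apply/implyP.
- by move=> /dom[/refl-> /refl->].
- by move=> /andP[rij rji]; apply/eqP; apply: anti.
- by move=> /andP[]; apply: trans.
- by move=> /andP[/dom[Ki _] /dom[Kj _]]; apply: tot.
Qed.

Definition splitting_code (ijkn : nat * nat * nat * nat) (z : nat -> nat) : bool :=
  lin_clause (code_rel z) ijkn.1.1.1 ijkn.1.1.2 ijkn.1.2 &&
  splits (code_rel z) (code_fun z) ijkn.2.

Definition splitting_codes : set (nat -> nat) :=
  [set z | forall ijkn, splitting_code ijkn z].

Lemma determined_code_rel f g : determined f -> determined g ->
  determined (fun z => code_rel z (f z) (g z)).
Proof.
move=> fd gd; apply/(determined1 odd)/determined_eval.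
exact: (determined2 (fun i j => pickle (i, j))).
Qed.

Lemma determined_slot k f : determined f ->
  determined (fun z => slot (code_fun z) k (f z)).
Proof.
move=> fd; apply/(determined1 half)/determined_eval.
exact: (determined1 (fun n => 6 * n + k)).
Qed.

Lemma splitting_codes_closed : baire_closed splitting_codes.
Proof.
apply: determined_closed => -[[[i j] k] n].
rewrite /splitting_code /lin_clause /splits /=.
by do ![exact: determined_cst|apply: (determined2 andb)|
  apply: (determined2 orb)|apply: (determined2 implb)|
  apply: (determined1 negb)|apply: determined_code_rel|
  apply: determined_slot].
Qed.

Lemma splitting_codes_lin (z : baire_sub splitting_codes) :
  lin_set (fun ij => code_rel (sval z) ij.1 ij.2).
Proof.
have zP := svalP z; apply/lin_clauseP.
  (* The domain contains the left end of interval 0: it is related to the right end, and the first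
     clause puts both on the diagonal. *)
  exists (slot (code_fun (sval z)) 0 0).
  have /andP[/and4P[/implyP + _ _ _] _] := zP (slot (code_fun (sval z)) 0 0,
    slot (code_fun (sval z)) 1 0, 0, 0).
  have /andP[_ /andP[-> _]] := zP (0, 0, 0, 0).
  by move=> /(_ isT)/andP[].
by move=> i j k; have /andP[] := zP (i, j, k, 0).
Qed.

Definition decode_lin (z : baire_sub splitting_codes) : Lin :=
  exist (fun f => f \in lin_set) _ (mem_set (splitting_codes_lin z)).

Lemma lin_rel_decode z : lin_rel (decode_lin z) = code_rel (sval z).
Proof. by rewrite /lin_rel set_valE. Qed.

Lemma analytic_StS_nonscat (R : realType) : @analytic R Lin (StS `\` Scat).
Proof.
exists (baire_sub splitting_codes); split.
  exact/baire_sub_polish/splitting_codes_closed.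
exists decode_lin; split.
  apply: continuous_Lin => i j; under eq_fun do rewrite lin_rel_decode.
  apply: (locally_constant_determined (f := fun z => code_rel z i j)).
  exact: determined_code_rel (determined_cst i) (determined_cst j).
apply/seteqP; split=> [_ [z _ <-]|x /StS_nonscat_splits[y xy]].
  apply/StS_nonscat_splits; exists (code_fun (sval z)) => n.
  by rewrite lin_rel_decode; have /andP[] := svalP z (0, 0, 0, n).
pose z m := nat_of_bool
  (if unpickle m is Some (i, j) then lin_rel x i j else false) + (y m).*2.
have zr : code_rel z = lin_rel x.
  apply/funext => i; apply/funext => j.
  by rewrite /code_rel /z pickleK oddD odd_double addbF oddb.
have zy : code_fun z = y.
  by apply/funext => n; rewrite /code_fun /z half_bit_double.
have zC : splitting_codes z.
  move=> [[[i j] k] n]; rewrite /splitting_code zr zy xy andbT /=.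
  apply: (lin_clauseP _).2; last first.
    have [K [K0 KP]] := lin_relP x; exists K; split=> //.
  by have [[p pP]] := lin_dom_inhabited x; exists p.
exists (exist _ z zC) => //; apply: val_inj => /=.
apply/funext => -[i j]; have := congr1 (fun r => r i j) zr.
by rewrite /lin_rel set_valE.
Qed.

(** * Hardness *)
Local Open Scope ring_scope.

Lemma near_clopen (X : topologicalType) (V : set X) x :
  clopen V -> \forall x' \near x, V x' <-> V x.
Proof.
move=> [Vo Vc]; have [Vx|nVx] := pselect (V x).
  have : nbhs x V by apply: open_nbhs_nbhs.
  by apply: filterS.
have : nbhs x (~` V) by apply: open_nbhs_nbhs; split; [apply: closed_openC|].
by apply: filterS.
Qed.

Lemma near_all_lt (X : Type) (F : set_system X) (P : nat -> X -> Prop)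
    {FF : Filter F} : (forall j, \forall x \near F, P j x) ->
  forall n, \forall x \near F, forall j, (j < n)%N -> P j x.
Proof.
move=> PF; elim=> [|n IHn]; first exact: nearW.
apply: filterS2 IHn (PF n) => x xP xn j; rewrite ltnS leq_eqVlt.
by move=> /predU1P[->//|/xP].
Qed.

(** * Approximation by a dense set *)

Section Metric.
Variables (R : realType) (X : topologicalType) (d : X -> X -> R) (D : set X).
Hypothesis d_sym : forall x y, d x y = d y x.
Hypothesis d_triangle : forall x y z, d x z <= d x y + d y z.
Hypothesis d_nbhs : forall (x : X) (A : set X),
  nbhs x A <-> exists2 e : R, 0 < e & [set y | d x y < e] `<=` A.
Hypothesis D_dense : dense D.

Lemma dense_near (x : X) (A : set X) : nbhs x A -> exists2 z, D z & A z.
Proof.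
move=> xA; have [||z [Az Dz]] := D_dense (O := A^°).
- by exists x; exact: xA.
- exact: open_interior.
- by exists z => //; exact: interior_subset Az.
Qed.

Lemma dense_dist (x : X) (n : nat) : exists2 z, D z & d z x < n.+1%:R^-1.
Proof.
have [|z Dz xz] := @dense_near x [set y | d x y < n.+1%:R^-1].
  by apply/d_nbhs; exists n.+1%:R^-1; rewrite ?invr_gt0 ?ltr0n.
by exists z; rewrite // d_sym.
Qed.

(** With [1/(n+1)] below half the radius of a ball around [x] inside [A], any point of [D] that
    close to [x] can be the centre. *)
Lemma dense_ball (x : X) (A : set X) : nbhs x A ->
  exists z n, [/\ D z, d z x < n.+1%:R^-1 & [set y | d z y < n.+1%:R^-1] `<=` A].
Proof.
move=> /d_nbhs[e e0 eA]; have [n] := @ltr_add_invr R 0 (e / 2) (divr_gt0 e0 (ltr0Sn R 1)).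
rewrite add0r => ne; have [z Dz zx] := dense_dist x n.
exists z, n; split=> // y /= zy; apply: eA => /=.
apply: le_lt_trans (d_triangle x z y) _; rewrite [ltRHS]splitr.
by apply: ltrD; apply: lt_trans ne => //; rewrite d_sym.
Qed.

End Metric.

(** The clopen base may be uncountable, but pairs of balls about dense points with radii [1/(n+1)]
    are countably many. For each pair that some clopen set separates, one such set is chosen. *)
Lemma separating_clopens (R : realType) (X : topologicalType) :
  polish R X -> clopen_based X -> exists C : nat -> set X,
    (forall j, clopen (C j)) /\
    forall x x', (forall j, C j x <-> C j x') -> x = x'.
Proof.
move=> [[D /countable_injP[code code_inj] D_dense] [d [d0 d_sym d_tri d_nbhs _]]].
move=> [U U_clopen [_ U_basis]].
(* The set [V] contains the first and misses the second of the balls coded by [j]; this is vacuous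
   if [j] codes no pair. *)
pose sep (V : set X) j := forall z z' n n', D z -> D z' ->
  unpickle j = Some (code z, n, (code z', n')) ->
  [set y | d z y < n.+1%:R^-1] `<=` V /\ [set y | d z' y < n'.+1%:R^-1] `<=` ~` V.
have /choice[C CP] : forall j, exists V : set X,
    clopen V /\ ((exists2 V', clopen V' & sep V' j) -> sep V j).
  move=> j; have [[V Vc Vj]|no] := pselect (exists2 V, clopen V & sep V j).
    by exists V.
  by exists set0; split=> //; apply: clopen0.
exists C; split=> [j|x x' CE]; first by have [] := CP j.
apply: contrapT => xx'.
have [V [UV Vx] Vx'] : exists2 V, U V /\ V x & ~ V x'.
  have dxx' : 0 < d x x'.
    rewrite lt_neqAle; apply/andP; split; first by apply/eqP => /esym/d0.
    have := d_tri x x' x; rewrite (d0 x x).2 // (d_sym x' x) -mulr2n.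
    by rewrite pmulrn_lge0.
  have [|V [UV Vx] Vd] := U_basis x [set y | d x y < d x x'].
    by apply/d_nbhs; exists (d x x').
  by exists V => // /Vd /=; rewrite ltxx.
have [Vo Vc] := U_clopen _ UV.
have [|z [n [Dz zx zV]]] := dense_ball d_sym d_tri d_nbhs D_dense (x := x) (A := V).
  exact: open_nbhs_nbhs.
have [|z' [n' [Dz' zx' zV']]] :=
    dense_ball d_sym d_tri d_nbhs D_dense (x := x') (A := ~` V).
  by apply: open_nbhs_nbhs; split=> //; apply: closed_openC.
pose j := pickle (code z, n, (code z', n')).
have Vj : sep V j.
  move=> w w' m m' Dw Dw'; rewrite /j pickleK => -[wz <- wz' <-].
  rewrite (code_inj w z) ?inE//; split; first exact: zV.
  by rewrite (code_inj w' z') ?inE.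
have [_ Cj] := CP j; have [||||Cx Cx'] := Cj _ z z' n n' => //.
- by exists V => //; apply: U_clopen.
- by rewrite /j pickleK.
by apply: (Cx' x') => //; apply/CE; apply: Cx.
Qed.

(* With [B = range f], [f : Y -> X]: a node of [T x] approximates a point [y] of
   [Y] by dense points and asks that [f y] be close to [x]. Finitely many of the
   clopens of [separating_clopens] are consulted, whence local constancy. *)
Lemma analytic_tree (R : realType) (X : topologicalType) (B : set X) :
  polish R X -> clopen_based X -> @analytic R X B ->
  exists T : X -> seq nat -> bool, [/\ forall x, T x [::],
    forall s, locally_constant (fun x => T x s) &
    forall x, B x <-> illfounded (T x)].
Proof.
move=> pX cX [Y [[[D /countable_injP[code code_inj] D_dense] [d dP]] [f [f_cont <-]]]].
have [d0 d_sym d_tri d_nbhs d_complete] := dP.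
have [C [C_clopen C_sep]] := separating_clopens pX cX.
pose T x s := (s == [::]) || `[< exists y,
  (forall i, (i < size s)%N ->
     exists z, [/\ D z, code z = nth 0%N s i & d z y < i.+1%:R^-1]) /\
  (forall j, (j < size s)%N -> (C j (f y) <-> C j x)) >].
exists T; split=> [x|s x|x]; first by [].
  have near_C := near_all_lt (fun j => near_clopen x (C_clopen j)) (size s).
  apply: filterS (near_C _) => x' xx'; congr (_ || _); apply: asbool_equiv_eq.
  by split=> -[y [yT yC]]; exists y; split=> // j js;
    rewrite yC//; [apply: xx'|apply: iff_sym; apply: xx'].
split=> [[y _ <-]|[b bT]].
  have /choice[z zP] : forall n, exists z, D z /\ d z y < n.+1%:R^-1.
    by move=> n; have [z] := dense_dist d_sym d_nbhs D_dense y n; exists z.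
  exists (code \o z) => n; apply/orP; right; apply/asboolP; exists y.
  rewrite size_mkseq; split=> // i ni; exists (z i).
  by have [Dz dz] := zP i; rewrite nth_mkseq.
have /choice[u uP] n : exists y,
    (forall i, (i <= n)%N -> exists z, [/\ D z, code z = b i & d z y < i.+1%:R^-1]) /\
    (forall j, (j <= n)%N -> (C j (f y) <-> C j x)).
  (* Length [n.+1] rules out the clause for the root and covers the index [n]. *)
  have /orP[//|/asboolP[y []]] := bT n.+1.
  rewrite size_mkseq => yz yC; exists y; split=> // i ni.
  by have [z [Dz cz zy]] := yz i ni; exists z; rewrite cz nth_mkseq.
have [|l ul] := d_complete u.
  move=> e e0; have [N] := @ltr_add_invr R 0 (e / 2) (divr_gt0 e0 (ltr0Sn R 1)).
  rewrite add0r => Ne; exists N => m n Nm Nn.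
  (* Both [u m] and [u n] are close to the same dense point, the one of code [b N]. *)
  have [z [Dz cz zm]] := (uP m).1 _ Nm; have [z' [Dz' cz' zn]] := (uP n).1 _ Nn.
  have {Dz' cz'} zz' : z' = z by apply: code_inj; rewrite ?inE// cz cz'.
  rewrite {}zz' in zn; apply: le_lt_trans (d_tri _ z _) _; rewrite [ltRHS]splitr.
  by apply: ltrD; apply: lt_trans Ne => //; rewrite d_sym.
(* For large [n], membership of [f (u n)] in [C j] agrees with that of [f l] by continuity, and with
   that of [x] by the choice of [u]. *)
exists l => //; apply: C_sep => j.
have fu : f \o u @ \oo --> f l by apply: cvg_comp ul _; apply: f_cont.
have ful : \forall n \near \oo, C j (f (u n)) <-> C j (f l).
  exact: fu (near_clopen _ (C_clopen j)).
have fux : \forall n \near \oo, C j (f (u n)) <-> C j x.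
  by exists j => // n jn; apply: (uP n).2.
have [n [nl nx]] := filter_ex (filterI ful fux).
by rewrite -nl.
Qed.

(** The reduction maps points with ill-founded tree into the smaller set and all others outside the
    larger one, so it works for every set in between. *)
Lemma hard_StS (R : realType) (A : set Lin) :
  StS `\` Scat `<=` A -> A `<=` StS -> hard R (@analytic R) A.
Proof.
move=> subA Asub X pX cX B aB.
have [T [T0 T_lc BT]] := analytic_tree pX cX aB.
exists (tree_reduction T0); split; first exact: continuous_tree_reduction.
apply/seteqP; split=> x /=.
  by move=> /BT/(tree_reductionP T0)/subA.
by move=> /Asub/tree_reduction_StS/BT.
Qed.

Theorem proposition3p3 (R : realType) :
  hard R (@analytic R) StS /\
  Sigma11 (StS `\` Scat) /\
  complete R (@analytic R) (StS `\` Scat).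
Proof.
have nonscat_sub : StS `\` Scat `<=` StS by move=> x [].
split; first exact: hard_StS.
split; first exact: Sigma11_StS_nonscat.
by split; [apply: analytic_StS_nonscat|apply: hard_StS].
Qed.
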